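(* Let $W$ be an infinite, irreducible Coxeter group with simple generators $s_1,\dots,s_n$, let $c$ be a Coxeter element of $W$, and let $x_1x_2\cdots x_N$ be any $c$-admissible sequence. Then the word $s_{x_1}s_{x_2}\cdots s_{x_N}$ is reduced.
   Context: $W$ is a Coxeter group of finite rank $n$: generated by $s_1,\dots,s_n$ subject to $s_i^2=1$ and $(s_is_j)^{m_{ij}}=1$ for $i\ne j$, $2\le m_{ij}=m_{ji}\le\infty$. Its Dynkin diagram $\Gamma$ has vertices $1,\dots,n$ and an edge $\{i,j\}$ whenever $m_{ij}\ne 2$; irreducible means $\Gamma$ is connected. A Coxeter element is an element of the form $s_{y_1}\cdots s_{y_n}$ with $y_1\cdots y_n$ a permutation of $\{1,\dots,n\}$. For a Coxeter element $c$, a vertex $x$ is called initial in $c$ if $c=s_{y_1}\cdots s_{y_n}$ for some permutation with $y_1=x$; in that case $s_xcs_x$ is again a Coxeter element. (Equivalently, orient each edge $\{i,j\}$ of $\Gamma$ from $j$ to $i$ when $s_i$ precedes $s_j$ in an expression of $c$; then $x$ is initial iff it is a sink, and passing to $s_xcs_x$ reverses all edges into $x$.) A sequence $x_1,\dots,x_N$ of vertices is $c$-admissible if, setting $c_0=c$ and $c_k=s_{x_k}c_{k-1}s_{x_k}$, each $x_k$ is initial in $c_{k-1}$ for $k=1,\dots,N$. A word is reduced if its number of letters equals the length of the element it represents. *)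

(* Defs.v *)
(* A Coxeter group of rank n is encoded by its Coxeter matrix
   m : 'I_n -> 'I_n -> nat, where the value 0 encodes m_ij = infinity.
   The group W is realised as words (seq 'I_n) modulo the congruence generated
   by the defining relations (s_i s_j)^{m_ij} = 1 (for m_ij finite; m_ii = 1
   gives s_i^2 = 1).  Since every generator is an involution, the monoid
   presented by these relations is exactly the group W. *)
From mathcomp Require Import all_boot.
Set Implicit Arguments. Unset Strict Implicit. Unset Printing Implicit Defensive.

Section Coxeter.
Variable n : nat.
Variable m : 'I_n -> 'I_n -> nat.

(* Coxeter matrix: symmetric, m_ii = 1, m_ij in {2,3,...} U {infinity(=0)} for i<>j *)
Definition coxeter_matrix : Prop :=
  [/\ forall i j, m i j = m j i,
      forall i, m i i = 1
    & forall i j, i != j -> m i j != 1].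

Definition braid_word (i j : 'I_n) (k : nat) : seq 'I_n :=
  flatten (nseq k [:: i; j]).

Inductive cox_eq : seq 'I_n -> seq 'I_n -> Prop :=
| cox_refl w : cox_eq w w
| cox_sym u v : cox_eq u v -> cox_eq v u
| cox_trans u v w : cox_eq u v -> cox_eq v w -> cox_eq u w
| cox_rel a b i j : m i j != 0 -> cox_eq (a ++ braid_word i j (m i j) ++ b) (a ++ b).

Definition coxeter_infinite : Prop :=
  ~ exists s : seq (seq 'I_n), forall w, exists2 u, u \in s & cox_eq w u.

Definition dynkin_rel : rel 'I_n := fun i j => (i != j) && (m i j != 2).

Definition coxeter_irreducible : Prop := forall i j, connect dynkin_rel i j.

Definition reduced (w : seq 'I_n) : Prop :=
  forall w', cox_eq w w' -> size w <= size w'.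

Definition perm_word (q : seq 'I_n) : bool := perm_eq q (enum 'I_n).

Definition initial (x : 'I_n) (c : seq 'I_n) : Prop :=
  exists q, perm_word (x :: q) /\ cox_eq (x :: q) c.

(* c-admissible sequences; c_k = s_{x_k} c_{k-1} s_{x_k} is represented by
   the word x_k :: c_{k-1} ++ [:: x_k] *)
Fixpoint admissible (c : seq 'I_n) (xs : seq 'I_n) : Prop :=
  match xs with
  | [::] => True
  | x :: xs' => initial x c /\ admissible (x :: c ++ [:: x]) xs'
  end.

End Coxeter.

(* Main.v *)
(* Speyer's argument. A Coxeter element c orients the Dynkin diagram and so defines a skew form
   omega_c on the root space, with omega_c(alpha_i, alpha_j) = -A_ij when i precedes j in c.
   Conjugating c by an initial x moves omega_c by s_x, and omega_c(alpha_x, -) >= 0 on positive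
   vectors when x is initial. Hence, for an admissible reduced word w leading from c to c', the
   right descents of w are closed under passing from j to a neighbour i that j precedes in c'.
   If some admissible word were not reduced, a reduced admissible w would have an initial vertex
   x of c' as a descent. Extend w by initial vertices that are not descents: x stays an initial
   descent, and since the diagram is connected, a letter at distance d from x is used at most d
   times, so this process stops. Then all initial vertices are descents, so all vertices are, and
   W is finite. *)
Require Import Defs.
From mathcomp Require Import all_boot all_order all_algebra boolp reals trigo Rstruct.
From mathcomp Require Import ring lra zify.
From Stdlib Require Import Setoid Morphisms.
Set Implicit Arguments. Unset Strict Implicit. Unset Printing Implicit Defensive.
Import Order.TTheory GRing.Theory Num.Theory.

(** * Words and reducedness *)

#[global] Hint Resolve cox_refl : core.

Section Words.
Variables (n : nat) (m : 'I_n -> 'I_n -> nat).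
Hypothesis mC : coxeter_matrix m.
Local Notation word := (seq 'I_n).
Local Notation "u ~~ v" := (cox_eq m u v) (at level 70).
Local Notation reduced := (reduced m).

#[global] Instance cox_eq_equiv : Equivalence (cox_eq m).
Proof.
split; [exact: cox_refl | exact: cox_sym | move=> u v w; exact: cox_trans].
Qed.

Lemma cox_eq_ctx a b u v : u ~~ v -> a ++ u ++ b ~~ a ++ v ++ b.
Proof.
elim=> {u v} [w|u v _|u v w _ uv _|c d i j mij].
- reflexivity.
- by symmetry.
- by transitivity (a ++ v ++ b).
by rewrite -!catA (catA a c) [a ++ c ++ _]catA; exact: cox_rel.
Qed.

#[global] Instance cox_eq_cat : Proper (cox_eq m ==> cox_eq m ==> cox_eq m) cat.
Proof.
move=> u u' uu' v v' vv'; transitivity (u' ++ v); first exact: (@cox_eq_ctx [::]).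
by have := @cox_eq_ctx u' [::] _ _ vv'; rewrite !cats0.
Qed.

#[global] Instance cox_eq_cons x : Proper (cox_eq m ==> cox_eq m) (cons x).
Proof. by move=> u v uv; rewrite -[x :: u]/([:: x] ++ u) uv. Qed.

Lemma cox_eq_rcons u v x : u ~~ v -> rcons u x ~~ rcons v x.
Proof. by move=> uv; rewrite -!cats1 uv. Qed.

Lemma braid_eq0 i j : m i j != 0 -> braid_word i j (m i j) ~~ [::].
Proof. by move=> mij; have := @cox_rel _ _ [::] [::] i j mij; rewrite cats0. Qed.

Lemma invol x : [:: x; x] ~~ [::].
Proof.
by case: mC => _ m1 _; have := @braid_eq0 x x; rewrite m1 => /(_ isT).
Qed.

Lemma invol_cons x u : x :: x :: u ~~ u.
Proof. by rewrite -[x :: x :: u]/([:: x; x] ++ u) invol. Qed.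

Lemma rcons_invol u x : rcons (rcons u x) x ~~ u.
Proof. by rewrite -!cats1 -catA /= invol cats0. Qed.

Lemma cat_rev u : u ++ rev u ~~ [::].
Proof.
elim: u => [|x u IH] /=; first reflexivity.
by rewrite rev_cons -cats1 catA IH /= invol.
Qed.

Lemma rev_cat0 u : rev u ++ u ~~ [::].
Proof. by have := cat_rev (rev u); rewrite revK. Qed.

Lemma cox_eq_inv u v : u ++ v ~~ [::] -> v ~~ rev u.
Proof.
move=> uv; transitivity (rev u ++ (u ++ v)); first by rewrite catA rev_cat0.
by rewrite uv cats0.
Qed.

Lemma cox_eq_rev u v : u ~~ v -> rev u ~~ rev v.
Proof. by move=> uv; apply: cox_eq_inv; rewrite -uv; exact: cat_rev. Qed.

Lemma size_braid_word (i j : 'I_n) k : size (braid_word i j k) = k.*2.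
Proof. by elim: k => //= k; rewrite /braid_word /= => ->. Qed.

Lemma cox_eq_odd u v : u ~~ v -> odd (size u) = odd (size v).
Proof.
elim=> // [u' v' w _ -> _ -> //|a b i j _].
by rewrite !size_cat size_braid_word !oddD odd_double.
Qed.

Lemma commute_word x a : (forall j, j \in a -> m x j = 2) -> x :: a ~~ rcons a x.
Proof.
elim: a => [|y a IH] ha /=; first reflexivity.
have xy : [:: x; y] ~~ [:: y; x].
  have := @braid_eq0 x y; rewrite (ha y) ?mem_head// => /(_ isT) h.
  by rewrite (@cox_eq_inv [:: x; y] [:: x; y] h).
rewrite -IH => [|j ja]; last by rewrite ha // inE ja orbT.
by rewrite -[x :: y :: a]/([:: x; y] ++ a) xy.
Qed.

Lemma reduced_eq u v : u ~~ v -> size v <= size u -> reduced u -> reduced v.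
Proof. by move=> uv vu ru w vw; apply: leq_trans vu (ru w _); rewrite uv. Qed.

Lemma reduced_factor a u b : reduced (a ++ u ++ b) -> reduced u.
Proof.
move=> r w uw; have := r _ (cox_eq_ctx a b uw).
by rewrite !size_cat leq_add2l leq_add2r.
Qed.

Lemma reduced_behead x u : reduced (x :: u) -> reduced u.
Proof. by move=> r; apply: (@reduced_factor [:: x] u [::]); rewrite cats0. Qed.

Lemma reduced_rconsl u x : reduced (rcons u x) -> reduced u.
Proof. by rewrite -cats1 => r; apply: (@reduced_factor [::] u [:: x]). Qed.

Lemma reduced1 x : reduced [:: x].
Proof. by move=> w /cox_eq_odd; case: w. Qed.

Lemma exists_reduced u : exists2 v, u ~~ v & reduced v.
Proof.
have [k] := ubnP (size u); elim: k u => // k IH u uk.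
have [ru|] := pselect (reduced u); first by exists u => //; reflexivity.
move=> /existsNP[w] /not_implyP[uw] /negP; rewrite -ltnNge => wu.
have [|v wv rv] := IH w; first by lia.
by exists v => //; rewrite uw.
Qed.

(** By parity, [rcons u x] cannot have the length of u, so its length is one less. Multiplying a
    reduced word for it by x gives back u. *)
Lemma descentP u x : reduced u -> ~ reduced (rcons u x) ->
  exists v, [/\ reduced v, reduced (rcons v x), u ~~ rcons v x & size u = (size v).+1].
Proof.
move=> ru /existsNP[w] /not_implyP[uw] /negP; rewrite -ltnNge size_rcons => wu.
have [v wv rv] := exists_reduced w.
have uv : u ~~ rcons v x.
  by rewrite -(rcons_invol u x); apply: cox_eq_rcons; rewrite uw.
have vw : size v <= size w by apply: rv; symmetry.
have uv1 := ru _ uv; rewrite size_rcons in uv1.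
have od := cox_eq_odd uv; rewrite size_rcons /= in od.
have odw := cox_eq_odd uw; rewrite size_rcons /= in odw.
have odv := cox_eq_odd wv.
have suv : size u = (size v).+1 by lia.
by exists v; split=> //; apply: reduced_eq uv _ ru; rewrite size_rcons suv.
Qed.

(* The word of length k alternating between s and t and ending in t. *)
Fixpoint alt_word (s t : 'I_n) k : word :=
  if k is k'.+1 then (if odd k' then s else t) :: alt_word s t k' else [::].

Lemma size_alt_word s t k : size (alt_word s t k) = k.
Proof. by elim: k => //= k ->. Qed.

Lemma rcons_alt_word s t k : rcons (alt_word s t k) s = alt_word t s k.+1.
Proof. by elim: k => //= k ->; rewrite if_neg. Qed.

Lemma alt_word_suffix s t i j : exists2 u, alt_word s t (i + j) = u ++ alt_word s t j & size u = i.
Proof.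
elim: i => [|i [u e su]]; first by exists [::].
by rewrite addSn /= e; eexists (_ :: u) => //=; rewrite su.
Qed.

Lemma alt_word_double s t k : alt_word s t k.*2 = braid_word s t k.
Proof.
elim: k => //= k; rewrite odd_double /= /braid_word /= => <-.
by [].
Qed.

(** The trivial braid word has 2m letters. Cut after m - 1 of them: the remaining m + 1 equal the
    inverse of a shorter word. *)
Lemma alt_word_nonreduced s t k : m t s != 0 -> m t s < k -> ~ reduced (alt_word t s k).
Proof.
move=> m0 mk; have -> : k = (k - (m t s).+1) + (m t s).+1 by lia.
have [u -> _] := alt_word_suffix t s (k - (m t s).+1) (m t s).+1.
move=> r; have {r} : reduced (alt_word t s (m t s).+1).
  by apply: (@reduced_factor u _ [::]); rewrite cats0.
have := braid_eq0 m0; rewrite -alt_word_double.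
have -> : (m t s).*2 = (m t s).-1 + (m t s).+1 by lia.
have [v -> sv] := alt_word_suffix t s (m t s).-1 (m t s).+1.
by move=> /cox_eq_inv /[swap] /[apply]; rewrite size_rev size_alt_word sv; lia.
Qed.
End Words.

(** * Chebyshev polynomials at 2 cos (pi / M) *)

Section Chebyshev.
Local Open Scope ring_scope.
Variable R : realType.

(** The Chebyshev polynomial of the second kind U_{k-1}(t/2), that is sin(k x) / sin x at t = 2 cos
    x. *)
Fixpoint cheb (t : R) k : R :=
  match k with
  | 0 => 0
  | 1 => 1
  | (k'.+1 as k1).+1 => t * cheb t k1 - cheb t k'
  end.

Lemma chebSS t k : cheb t k.+2 = t * cheb t k.+1 - cheb t k.
Proof. by []. Qed.

(** The recursion preserves this quadratic form, whose value at k = 0 is 1. *)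
Lemma cheb_norm t k :
  cheb t k.+1 ^+ 2 + cheb t k ^+ 2 - t * cheb t k * cheb t k.+1 = 1.
Proof.
elim: k => [|k IH]; first by rewrite /=; ring.
by rewrite chebSS -{}IH; ring.
Qed.

Lemma sin_cheb (x : R) k : sin x * cheb (2 * cos x) k = sin (x *+ k).
Proof.
suff: sin x * cheb (2 * cos x) k = sin (x *+ k) /\
      sin x * cheb (2 * cos x) k.+1 = sin (x *+ k.+1) by case.
elim: k => [|k [IH1 IH2]]; first by rewrite /= mulr0 mulr1 mulr0n sin0.
split=> //; rewrite chebSS mulrBr mulrCA IH1 IH2.
have -> : x *+ k = x *+ k.+1 - x by rewrite mulrSr addrK.
by rewrite [x *+ k.+2]mulrSr sinB trigo.sinD; ring.
Qed.

(* As [0^-1 = 0], the code 0 for an infinite label gives [2 * cos 0 = 2], as it should. *)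
Definition two_cos (M : nat) : R := 2 * cos (pi / M%:R).

Lemma two_cos0 : two_cos 0 = 2.
Proof. by rewrite /two_cos invr0 mulr0 cos0 mulr1. Qed.

Lemma two_cos1 : two_cos 1 = - 2.
Proof. by rewrite /two_cos divr1 cospi mulrN1. Qed.

Lemma cheb_two k : cheb 2 k = k%:R.
Proof.
suff: cheb 2 k = k%:R /\ cheb 2 k.+1 = k.+1%:R by case.
elim: k => [|k [IH1 IH2]]; first by [].
by split=> //; rewrite chebSS IH1 IH2; ring.
Qed.

Lemma sin_pi_div_gt0 M : (1 < M)%N -> 0 < sin (pi / M%:R : R).
Proof.
move=> M1; have M0 : 0 < M%:R :> R by rewrite ltr0n; lia.
apply: sin_gt0_pi; rewrite divr_gt0 ?pi_gt0 //=.
by rewrite ltr_pdivrMr // ltr_pMr ?pi_gt0 // ltr1n.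
Qed.

(** Up to the factor sin(pi/M) > 0 the value is sin(k pi/M), with angle in [0, pi]; for an infinite
    label it is k. *)
Lemma cheb_ge0 M k : M != 1 -> (M != 0 -> (k <= M)%N) -> 0 <= cheb (two_cos M) k.
Proof.
case: M => [|M]; first by rewrite two_cos0 cheb_two.
move=> M1 /(_ isT) kM; have {}M1 : (1 < M.+1)%N by lia.
rewrite -(pmulr_rge0 _ (sin_pi_div_gt0 M1)) sin_cheb.
apply: sin_ge0_pi; rewrite mulrn_wge0 ?divr_ge0 ?pi_ge0 //=.
by rewrite -[_ *+ k]mulr_natr mulrAC ler_pdivrMr ?ltr0n // ler_pM2l ?pi_gt0 // ler_nat.
Qed.

Lemma cheb_eq0 M : (1 < M)%N -> cheb (two_cos M) M = 0.
Proof.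
move=> M1; apply: (mulfI (lt0r_neq0 (sin_pi_div_gt0 M1))).
by rewrite sin_cheb mulr0 -[_ *+ M]mulr_natr divfK ?sinpi // pnatr_eq0; lia.
Qed.

Lemma two_cos_ge0 M : M != 1 -> 0 <= two_cos M.
Proof.
by move=> M1; have := @cheb_ge0 M 2 M1; rewrite chebSS /= mulr1 subr0; apply; lia.
Qed.

Lemma two_cos2 : two_cos 2 = 0.
Proof. by have := @cheb_eq0 2 isT; rewrite chebSS /= mulr1 subr0. Qed.

Lemma two_cos_gt0 M : M != 1 -> M != 2 -> 0 < two_cos M.
Proof.
move=> M1 M2; rewrite lt0r two_cos_ge0 // andbT; apply/eqP => t0.
(* The third value is t^2 - 1, which would be -1 at t = 0; yet M is 0 or at least 3. *)
have := @cheb_ge0 M 3 M1; rewrite !chebSS t0 /= => h.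
have : 0 <= 0 * (0 * 1 - 0) - 1 :> R by apply: h; lia.
lra.
Qed.
End Chebyshev.

(** * The geometric representation *)

Section Geometry.
Local Open Scope ring_scope.
Variables (R : realType) (n : nat) (m : 'I_n -> 'I_n -> nat).
Hypothesis mC : coxeter_matrix m.
Local Notation word := (seq 'I_n).
Local Notation "u ~~ v" := (cox_eq m u v) (at level 70).
Local Notation reduced := (reduced m).

(** Twice the usual bilinear form on simple roots; the label 1 yields the diagonal entry -2 cos pi =
    2. *)
Definition cartan : 'M[R]_n := \matrix_(i, j) - two_cos R (m i j).
Local Notation A := cartan.
Local Notation e x := (delta_mx x 0 : 'cV[R]_n).

Lemma cartanC i j : A i j = A j i.
Proof. by case: mC => sym _ _; rewrite !mxE sym. Qed.

Lemma cartan_diag i : A i i = 2.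
Proof. by case: mC => _ m1 _; rewrite mxE m1 two_cos1 opprK. Qed.

Lemma cartan_le0 i j : i != j -> A i j <= 0.
Proof.
by case: mC => _ _ m1 ij; rewrite mxE oppr_le0; apply/two_cos_ge0/m1.
Qed.

Lemma cartan_lt0 i j : dynkin_rel m i j -> A i j < 0.
Proof.
by case: mC => _ _ m1 /andP[ij ?]; rewrite mxE oppr_lt0 two_cos_gt0 // m1.
Qed.

Lemma cartan_eq0 i j : i != j -> ~~ dynkin_rel m i j -> A i j = 0.
Proof.
by move=> ij; rewrite /dynkin_rel ij negbK mxE => /eqP ->; rewrite two_cos2 oppr0.
Qed.

(** In coordinates over the simple roots, v goes to v - (A v)_x alpha_x: only coordinate x
    changes. *)
Definition refl_mx x : 'M[R]_n := 1%:M - delta_mx x x *m A.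
Definition word_mx (w : word) : 'M[R]_n := foldr (fun x M => refl_mx x *m M) 1%:M w.
Local Notation S := refl_mx.
Local Notation W := word_mx.

Lemma word_mx_cat u v : W (u ++ v) = W u *m W v.
Proof. by elim: u => [|x u IH] /=; rewrite ?mul1mx // IH mulmxA. Qed.

Lemma word_mx_rcons u x : W (rcons u x) = W u *m S x.
Proof. by rewrite -cats1 word_mx_cat /= mulmx1. Qed.

Lemma cartan_col i x : (A *m e x) i 0 = A i x.
Proof. by rewrite -colE mxE. Qed.

Lemma word_col w i x : (W w *m e x) i 0 = W w i x.
Proof. by rewrite -colE mxE. Qed.

Lemma refl_mul x (v : 'cV[R]_n) : S x *m v = v - (A *m v) x 0 *: e x.
Proof.
rewrite mulmxBl mul1mx -mulmxA; congr (_ - _).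
apply/matrixP => i j; rewrite !ord1 [LHS]mxE (bigD1 x) //= big1 => [|k kx].
  by rewrite !mxE !eqxx andbT addr0 mulrC.
by rewrite !mxE (negbTE kx) andbF mul0r.
Qed.

Lemma refl_mulE x (v : 'cV[R]_n) i :
  (S x *m v) i 0 = v i 0 - (i == x)%:R * (A *m v) x 0.
Proof. by rewrite refl_mul !mxE andbT mulrC. Qed.

Lemma refl_root x : S x *m e x = - e x.
Proof.
by rewrite refl_mul cartan_col cartan_diag scaler_nat mulr2n opprD addrA subrr sub0r.
Qed.

(* The coefficients are the sums over l < k of g U_(2l+1) + f U_(2l) and g U_(2l+2) + f U_(2l+1),
   with U = cheb t. In closed form they all have the factor U_k, which vanishes at k = m i j. *)
Lemma braid_mul i j k (v : 'cV[R]_n) :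
  let t := two_cos R (m i j) in let a := cheb t k in let b := cheb t k.+1 in
  let f := (A *m v) i 0 in let g := (A *m v) j 0 in
  W (braid_word i j k) *m v =
  v - (g * a ^+ 2 + f * a * (t * a - b)) *: e j - (g * a * b + f * a ^+ 2) *: e i.
Proof.
move=> t a b f g; rewrite {}/a {}/b.
elim: k => [|k IH]; first by rewrite mul1mx /= expr2 !(mulr0, mul0r, addr0, scale0r, subr0).
rewrite [W _]/= -/(W _) -/(braid_word i j k) -!mulmxA {}IH.
have N := cheb_norm t k; rewrite [cheb t k.+2]chebSS.
set a := cheb t k in N *; set b := cheb t k.+1 in N *.
have Aij : A i j = - t by rewrite mxE.
have Aji : A j i = - t by rewrite cartanC.
have dot x (X Y : R) : (A *m (v - X *: e j - Y *: e i)) x 0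
    = (A *m v) x 0 - X * A x j - Y * A x i.
  rewrite -!cartan_col !mulmxBr -!scalemxAr.
  by move: (A *m v) (A *m e j) (A *m e i) => u1 u2 u3; rewrite !mxE.
rewrite [S j *m _]refl_mul dot cartan_diag Aji -/g.
have cmb (X Y Z : R) : v - X *: e j - Y *: e i - Z *: e j
    = v - (X + Z) *: e j - Y *: e i.
  by rewrite scalerDl opprD addrA -!addrA; do 2!congr (_ + _); rewrite addrC.
rewrite cmb refl_mul dot cartan_diag Aij -/f -[LHS]addrA -opprD -scalerDl.
congr (_ - _ - _); congr (_ *: _).
  (* For both coefficients the two sides differ by a multiple of the relation N. *)
  apply/eqP; rewrite -subr_eq0; apply/eqP.
  transitivity (g * (1 - (b ^+ 2 + a ^+ 2 - t * a * b))); first by ring.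
  by rewrite N subrr mulr0.
apply/eqP; rewrite -subr_eq0; apply/eqP.
transitivity ((f + t * g) * (1 - (b ^+ 2 + a ^+ 2 - t * a * b))); first by ring.
by rewrite N subrr mulr0.
Qed.

Lemma mulmx_colI (M N : 'M[R]_n) : (forall v : 'cV[R]_n, M *m v = N *m v) -> M = N.
Proof.
move=> MN; apply/matrixP => i j; have := MN (e j).
by rewrite -!colE => /matrixP/(_ i 0); rewrite !mxE.
Qed.

Lemma word_mx_eq u v : u ~~ v -> W u = W v.
Proof.
elim=> {u v} // [u v w _ -> _ -> //|a b i j mij].
rewrite !word_mx_cat; suff -> : W (braid_word i j (m i j)) = 1%:M by rewrite mul1mx.
(* The case i = j is checked directly: there the label is 1 and [cheb] at 1 does not vanish. *)
apply: mulmx_colI => v; rewrite mul1mx; have [->|ij] := eqVneq i j.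
  case: (mC) => _ -> _; rewrite /= mulmx1 -mulmxA [S j *m v]refl_mul mulmxBr.
  by rewrite -scalemxAr refl_root refl_mul scalerN opprK subrK.
case: (mC) => _ _ /(_ _ _ ij) m1.
rewrite (@braid_mul i j (m i j) v) cheb_eq0; last by lia.
by rewrite expr2 !(mulr0, mul0r, addr0, scale0r, subr0).
Qed.

Definition nonneg w s := forall i, 0 <= W w i s.

Lemma nonneg_mul (M : 'M[R]_n) s t (a b : R) i :
  0 <= a -> 0 <= b -> 0 <= M i s -> 0 <= M i t ->
  0 <= (M *m (a *: e s + b *: e t)) i 0.
Proof.
move=> a0 b0 Ms Mt.
by rewrite mulmxDr -!scalemxAr -!colE !mxE addr_ge0 ?mulr_ge0.
Qed.

(** Letters act from the right end of the word, each performing one step of the Chebyshev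
    recursion. *)
Lemma alt_word_root s t k : s != t ->
  W (alt_word s t k) *m e s =
  cheb (two_cos R (m s t)) k.+1 *: e (if odd k then t else s) +
  cheb (two_cos R (m s t)) k *: e (if odd k then s else t).
Proof.
move=> st; elim: k => [|k IH]; first by rewrite mul1mx /= scale1r scale0r addr0.
rewrite [W _]/= -/(W _) -mulmxA {}IH chebSS; set T := two_cos _ _.
set y := if odd k then s else t; set x := if odd k then t else s.
have Ayx : A y x = - T.
  by rewrite /x /y; case: ifP => _; [|rewrite cartanC]; rewrite mxE.
have -> : (if odd k.+1 then t else s) = y by rewrite /y /=; case: odd.
have -> : (if odd k.+1 then s else t) = x by rewrite /x /=; case: odd.
rewrite mulmxDr -!scalemxAr refl_root refl_mul cartan_col Ayx.
rewrite scalerBr !scaleNr !scalerN opprK scalerBl scalerA [cheb T k.+1 * T]mulrC.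
by rewrite -addrA [LHS]addrC.
Qed.

(* The column s of [word_mx w] is the root w alpha_s. Writing w = v u with u a longest possible
   alternating suffix in s and the last letter t of w, both v s and v t are reduced, and u alpha_s
   is a nonnegative combination of alpha_s and alpha_t. *)
Lemma reduced_nonneg w s : reduced (rcons w s) -> nonneg w s.
Proof.
have [N] := ubnP (size w); elim: N w s => // N IH w s.
case/lastP: w => [|w' t]; first by move=> _ _ i; rewrite mxE ler0n.
set w := rcons w' t => wN rws; have rw := reduced_rconsl rws.
have st : s != t.
  apply/eqP => st; have := rws w'; rewrite /w st => /(_ (rcons_invol mC w' t)).
  by rewrite !size_rcons; lia.
pose P k := `[< exists v, v ++ alt_word s t k ~~ w /\ (size v + k = size w)%N >].
have P1 : P 1 by apply/asboolP; exists w'; rewrite /w size_rcons -cats1 addn1.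
have Pmax k : P k -> (k <= size w)%N by move=> /asboolP[v [_ <-]]; apply: leq_addl.
have [k /asboolP[v [vw sv]] kmax] := ex_maxnP (ex_intro (fun k => P k) 1%N P1) Pmax.
have k1 := kmax _ P1.
have rvd : reduced (v ++ alt_word s t k).
  by apply: reduced_eq rw; [symmetry | rewrite size_cat size_alt_word sv].
have rv : reduced v by apply: (@reduced_factor _ _ [::] v (alt_word s t k)).
have rvds : reduced (v ++ alt_word t s k.+1).
  rewrite -rcons_alt_word -rcons_cat; apply: reduced_eq rws.
    by apply: cox_eq_rcons; symmetry.
  by rewrite [X in (_ <= X)%N]size_rcons size_rcons size_cat size_alt_word sv.
(* Appending s keeps the word reduced, so k + 1 alternating letters must not exceed the label. *)
have km : m s t != 0 -> (k < m s t)%N.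
  move=> m0; rewrite ltnNge; apply/negP => mk.
  have rd : reduced (alt_word t s k.+1).
    by apply: (@reduced_factor _ _ v _ [::]); rewrite cats0.
  have mst : m t s = m s t by case: mC.
  by apply: alt_word_nonreduced rd; rewrite ?mst.
(* [y k] would prolong the alternating suffix on the left, and [y k.+1] is its first letter. If v
   had the former as a descent, k would not be maximal; if the latter, w would not be reduced. *)
pose y k := if odd k then s else t.
have rvy : reduced (rcons v (y k)).
  have [//|/(descentP mC rv) [v' [_ _ vv' sv']]] := pselect (reduced (rcons v (y k))).
  suff /kmax : P k.+1 by rewrite ltnn.
  apply/asboolP; exists v'; split; last by lia.
  by rewrite -[alt_word _ _ _]/(y k :: alt_word s t k) -cat_rcons -vv'.
have rvy' : reduced (rcons v (y k.+1)).
  have [//|/(descentP mC rv) [v' [_ _ vv' sv']]] := pselect (reduced (rcons v (y k.+1))).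
  have ke : k = k.-1.+1 by lia.
  suff /(rvd _) : v ++ alt_word s t k ~~ v' ++ alt_word s t k.-1.
    by rewrite !size_cat !size_alt_word; lia.
  rewrite {1}ke -[alt_word _ _ k.-1.+1]/(y k.-1 :: alt_word s t k.-1).
  have -> : y k.-1 = y k.+1 by rewrite {2}ke /y /= negbK.
  by rewrite vv' cat_rcons invol_cons.
move=> i; rewrite -(word_mx_eq vw) -word_col word_mx_cat -mulmxA alt_word_root //.
case: (mC) => _ _ /(_ _ _ st) m1.
apply: nonneg_mul.
- by apply: cheb_ge0 => //; move=> /km; lia.
- by apply: cheb_ge0 => //; move=> /km; lia.
- by apply: IH; [lia | move: rvy'; rewrite /y /=; case: odd].
- by apply: IH; [lia | exact: rvy].
Qed.

Lemma descent_nonpos w s : reduced w -> ~ reduced (rcons w s) -> forall i, W w i s <= 0.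
Proof.
move=> rw /(descentP mC rw) [v [_ /reduced_nonneg vs wv _]] i.
rewrite (word_mx_eq wv) -word_col word_mx_rcons -mulmxA refl_root mulmxN.
by rewrite mxE word_col oppr_le0.
Qed.

(** Otherwise w alpha_s would be both nonnegative and nonpositive, hence zero, although w acts
    invertibly. *)
Lemma descent_of_nonpos w s : reduced w -> (forall i, W w i s <= 0) -> ~ reduced (rcons w s).
Proof.
move=> rw ws /reduced_nonneg ws'.
have w0 : W w *m e s = 0.
  by apply/matrixP => i j; rewrite ord1 word_col mxE; apply/le_anti/andP.
have := word_mx_eq (rev_cat0 mC w); rewrite word_mx_cat => /(congr1 (mulmx^~ (e s))).
rewrite -mulmxA w0 mulmx0 mul1mx => /matrixP/(_ s 0); rewrite !mxE !eqxx => /eqP.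
by rewrite eq_sym oner_eq0.
Qed.

End Geometry.

(** * Orientations of the Dynkin diagram *)

Section Firing.
Variables (n : nat) (m : 'I_n -> 'I_n -> nat).
Hypothesis mC : coxeter_matrix m.
Local Notation word := (seq 'I_n).
Local Notation "u ~~ v" := (cox_eq m u v) (at level 70).
Local Notation reduced := (reduced m).
Local Notation dyn := (dynkin_rel m).

(* A Coxeter element is represented by a permutation word p; the edge {i, j} points to i when i
   comes first in p. Moving a sink x to the end of p represents conjugation by s_x. *)
Definition sink (p : word) x := forall j, dyn x j -> index x p < index j p.
Definition push (p : word) x := rcons (rem x p) x.
Fixpoint fires (p w : word) : Prop :=
  if w is x :: w' then sink p x /\ fires (push p x) w' else True.
Definition pushes := foldl push.

Lemma dynkin_sym i j : dyn i j = dyn j i.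
Proof. by case: mC => sym _ _; rewrite /dynkin_rel eq_sym sym. Qed.

Lemma mem_perm_word (p : word) x : perm_word p -> x \in p.
Proof. by move=> /perm_mem ->; rewrite mem_enum. Qed.

Lemma perm_word_uniq (p : word) : perm_word p -> uniq p.
Proof. by move=> /perm_uniq ->; rewrite enum_uniq. Qed.

Lemma perm_word_push p x : perm_word p -> perm_word (push p x).
Proof.
move=> pp; rewrite /perm_word; apply: (perm_trans _ pp).
by rewrite /push perm_rcons perm_sym perm_to_rem // mem_perm_word.
Qed.

Lemma perm_word_pushes p w : perm_word p -> perm_word (pushes p w).
Proof. by elim: w p => //= x w IH p pp; apply/IH/perm_word_push. Qed.

Lemma pushE a x b : x \notin a -> push (a ++ x :: b) x = a ++ rcons b x.
Proof.
rewrite /push; elim: a => [|y a IH] /=; first by rewrite eqxx.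
by rewrite inE negb_or => /andP[xy /IH]; rewrite eq_sym (negbTE xy) /= => ->.
Qed.

Lemma perm_word_split (p : word) x : perm_word p -> exists a b, p = a ++ x :: b /\ x \notin a.
Proof.
move=> pp; have u := perm_word_uniq pp; move: u; case: (splitPr (mem_perm_word x pp)) => a b.
rewrite cat_uniq /= negb_or => /and3P[_ /andP[xa _] _].
by exists a, b.
Qed.

Lemma index_push p x i j : perm_word p -> i != x -> j != x ->
  (index i (push p x) < index j (push p x)) = (index i p < index j p).
Proof.
move=> pp ix jx; have := mem_perm_word i pp; have := mem_perm_word j pp.
have [a [b [-> xa]]] := perm_word_split x pp; rewrite pushE //.
rewrite !mem_cat !inE (negbTE ix) (negbTE jx) /= => ja ia.
rewrite !index_cat /= ![x == _]eq_sym (negbTE ix) (negbTE jx) -cats1 !index_cat.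
have /implyP := index_mem i a; have := index_mem j a.
by case: (i \in a) ia => /= [_|->]; case: (j \in a) ja => /= [_|->]; lia.
Qed.

Lemma index_push_last p x i : perm_word p -> i != x -> index i (push p x) < index x (push p x).
Proof.
move=> pp ix; have := mem_perm_word i (perm_word_push x pp).
have := perm_word_uniq (perm_word_push x pp).
rewrite /push rcons_uniq => /andP[xr _]; rewrite mem_rcons inE (negbTE ix) /= => ir.
by rewrite -cats1 !index_cat ir (negbTE xr) /= eqxx addn0 index_mem.
Qed.

Lemma sink_push p x y : perm_word p -> sink p x -> sink p y -> y != x -> sink (push p y) x.
Proof.
move=> pp sx sy yx j xj; have [->|jy] := eqVneq j y.
  by apply: index_push_last => //; rewrite eq_sym.
by rewrite index_push //; [apply: sx | rewrite eq_sym].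
Qed.

Lemma sink_nadj p x y : sink p x -> sink p y -> ~~ dyn x y.
Proof.
move=> sx sy; apply/negP => xy; have := sx y xy.
by rewrite ltnNge ltnW // sy // dynkin_sym.
Qed.

Lemma fires_cat p u v : fires p (u ++ v) <-> fires p u /\ fires (pushes p u) v.
Proof. by elim: u p => [|x u IH] p /=; [tauto | rewrite IH; tauto]. Qed.

Lemma fires_rcons p w x : fires p (rcons w x) <-> fires p w /\ sink (pushes p w) x.
Proof. by rewrite -cats1 fires_cat /=; tauto. Qed.

(** Two sinks are never adjacent, so while x remains an unfired sink no neighbour of x can fire. *)
Lemma sink_pushes p x z : perm_word p -> sink p x -> fires p z -> x \notin z ->
  sink (pushes p z) x /\ (forall y, y \in z -> m x y = 2).
Proof.
move=> + + + xz; elim: z p xz => [|y z IH] p //=.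
rewrite inE negb_or => /andP[xy xz] pp sx [sy fz].
have yx : y != x by rewrite eq_sym.
have [sx' com] := IH _ xz (perm_word_push y pp) (sink_push pp sx sy yx) fz.
split=> // k; rewrite inE => /predU1P[->|/com //].
by have := sink_nadj sx sy; rewrite /dynkin_rel xy negbK => /eqP.
Qed.

(* Firings of the two ends of an edge alternate. *)
Lemma count_fires p z u v : perm_word p -> dyn u v -> fires p z ->
  count_mem v z + (index v (pushes p z) < index u (pushes p z)) =
  count_mem u z + (index v p < index u p).
Proof.
move=> pp uv; have vu : dyn v u by rewrite dynkin_sym.
have /andP[nuv _] := uv; have nvu : v != u by rewrite eq_sym.
elim: z p pp => [|y z IH] p pp //= [sy fz].
have := IH _ (perm_word_push y pp) fz.
have [yv|yv] := eqVneq y v.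
  rewrite -yv in vu nuv nvu *; rewrite (negbTE nvu) (sy _ vu).
  by rewrite [index y (push p y) < _]ltnNge (ltnW (index_push_last pp nuv)) /=; lia.
have [yu|yu] := eqVneq y u.
  rewrite -yu in uv nuv nvu *; rewrite index_push_last //.
  by have := sy _ uv; rewrite [index v p < _]ltnNge => /ltnW -> /=; lia.
by rewrite index_push 1?eq_sym //; lia.
Qed.

(** By alternation the counts of neighbours differ by at most one, so the length of a path from x
    serves as k. *)
Lemma count_fires_bound p x y : perm_word p -> connect dyn x y ->
  exists k, forall z, fires p z -> x \notin z -> count_mem y z <= k.
Proof.
move=> pp /connectP[s + ->]; elim/last_ind: s => [_|s v IH].
  by exists 0 => z _ /count_memPn ->.
rewrite rcons_path last_rcons => /andP[/IH[k hk] dv].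
exists k.+1 => z fz xz; have := count_fires pp dv fz.
move=> /eq_leq /(leq_trans (leq_addr _ _)) /leq_trans; apply.
by rewrite -[k.+1]addn1 leq_add ?hk ?leq_b1.
Qed.

Lemma size_count (z : word) : size z = \sum_y count_mem y z.
Proof.
elim: z => [|x z IH] /=; first by rewrite big1.
rewrite big_split /= -IH (bigD1 x) //= eqxx big1 // => i ix.
by rewrite eq_sym (negbTE ix).
Qed.

Lemma fires_bound p x : perm_word p -> coxeter_irreducible m ->
  exists N, forall z, fires p z -> x \notin z -> size z <= N.
Proof.
move=> pp irr; have [f hf] := fin_all_exists (fun y => count_fires_bound pp (irr x y)).
by exists (\sum_y f y) => z fz xz; rewrite size_count; apply: leq_sum => y _; apply: hf.
Qed.

End Firing.

(** * The skew form of a Coxeter element *)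

Section Skew.
Local Open Scope ring_scope.
Variables (R : realType) (n : nat) (m : 'I_n -> 'I_n -> nat).
Hypothesis mC : coxeter_matrix m.
Local Notation word := (seq 'I_n).
Local Notation "u ~~ v" := (cox_eq m u v) (at level 70).
Local Notation reduced := (reduced m).
Local Notation dyn := (dynkin_rel m).
Local Notation sink := (sink m).
Local Notation fires := (fires m).
Local Notation A := (cartan R m).
Local Notation S := (refl_mx R m).
Local Notation W := (word_mx R m).
Local Notation e x := (delta_mx x 0 : 'cV[R]_n).

Lemma mx_entry (B : 'M[R]_n) i j : B i j = ((e i)^T *m B *m e j) 0 0.
Proof. by rewrite -mulmxA -colE trmx_delta -rowE !mxE. Qed.

Lemma refl_conj (B : 'M[R]_n) x i j :
  ((S x)^T *m B *m S x) i j =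
  B i j - A x i * B x j - A x j * B i x + A x i * A x j * B x x.
Proof.
rewrite [LHS]mx_entry !mulmxA -trmx_mul -!mulmxA !refl_mul !cartan_col.
rewrite linearB linearZ /= !mulmxBl !mulmxBr -!scalemxAl -!scalemxAr !mulmxA.
rewrite (mx_entry B i j) (mx_entry B x j) (mx_entry B i x) (mx_entry B x x).
move: (_ *m _) (_ *m _) (_ *m _) (_ *m _) => a b c d; rewrite !mxE; ring.
Qed.

Definition skew_form (p : word) : 'M[R]_n :=
  \matrix_(i, j) (if (index i p < index j p)%N then - A i j
                  else if (index j p < index i p)%N then A i j else 0).

Lemma skew_form_lt p i j : (index i p < index j p)%N -> skew_form p i j = - A i j.
Proof. by move=> ij; rewrite mxE ij. Qed.

Lemma skew_form_gt p i j : (index j p < index i p)%N -> skew_form p i j = A i j.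
Proof. by move=> ji; rewrite mxE ltnNge ltnW // ji. Qed.

Lemma skew_form_diag p i : skew_form p i i = 0.
Proof. by rewrite mxE ltnn. Qed.

Lemma skew_form_sink p x j : sink p x -> j != x ->
  skew_form p x j = - A x j /\ skew_form p j x = A x j.
Proof.
move=> sx jx; have [xj|xj] := boolP (dyn x j).
  by rewrite skew_form_lt ?skew_form_gt ?sx // (cartanC R mC j).
have Axj : A x j = 0 by rewrite cartan_eq0 // eq_sym.
by rewrite [skew_form p x j]mxE [skew_form p j x]mxE (cartanC R mC j) Axj oppr0 !if_same.
Qed.

(** Off x, row x of the form is -A and column x is A. The two corrections therefore cancel on
    entries away from x, while A x x = 2 flips the sign of those at x. *)
Lemma skew_form_push p x : perm_word p -> sink p x ->
  (S x)^T *m skew_form p *m S x = skew_form (push p x).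
Proof.
move=> pp sx; apply/matrixP => i j.
rewrite refl_conj skew_form_diag mulr0 addr0.
have [->|ix] := eqVneq i x; have [->|jx] := eqVneq j x.
- by rewrite !skew_form_diag !mulr0 !subr0.
- have [-> _] := skew_form_sink sx jx.
  rewrite (skew_form_gt (index_push_last pp jx)) skew_form_diag cartan_diag //; ring.
- have [_ ->] := skew_form_sink sx ix.
  rewrite (skew_form_lt (index_push_last pp ix)) skew_form_diag cartan_diag //.
  rewrite (cartanC R mC i); ring.
have [[-> _] [_ ->]] := (skew_form_sink sx jx, skew_form_sink sx ix).
rewrite (_ : skew_form (push p x) i j = skew_form p i j); last by rewrite !mxE !index_push.
ring.
Qed.

Lemma skew_form_pushes p w : perm_word p -> fires p w ->
  (W w)^T *m skew_form p *m W w = skew_form (pushes p w).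
Proof.
elim: w p => [|x w IH] p pp /= => [_|[sx fw]]; first by rewrite trmx1 mul1mx mulmx1.
by rewrite -IH ?perm_word_push // -skew_form_push // trmx_mul !mulmxA.
Qed.

(* Cut the word at the letter x where the root of j turns negative: there the root is a positive
   multiple of alpha_x, and x is last in the orientation, so omega against the root of i could not
   be positive if that root were. *)
Lemma descent_up p w i j : perm_word p -> fires p w -> reduced w ->
  ~ reduced (rcons w j) -> dyn j i -> (index j (pushes p w) < index i (pushes p w))%N ->
  ~ reduced (rcons w i).
Proof.
elim: w p => [|x w IH] p pp; first by move=> _ _ []; exact: reduced1.
move=> /= [sx fw] rxw nrj ji ltji ri; have rw := reduced_behead rxw.
have pp' := perm_word_push x pp.
have [rj|nrj'] := pselect (reduced (rcons w j)); last first.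
  exact: (IH _ pp' fw rw nrj' ji ltji (reduced_behead ri)).
have gamma0 := reduced_nonneg R mC rj.
have nonpos := descent_nonpos R mC rxw nrj.
have delta0 := reduced_nonneg R mC (reduced_behead ri).
(* The reflection in x leaves the other coordinates alone, so they are both nonnegative and
   nonpositive. *)
have gammaE k : k != x -> W w k j = 0.
  move=> kx; apply/le_anti; rewrite gamma0 andbT.
  by have := nonpos k; rewrite -word_col /= -mulmxA refl_mulE (negbTE kx) mul0r subr0 word_col.
have := skew_form_pushes pp' fw => /matrixP/(_ j i); rewrite (skew_form_lt ltji).
rewrite mxE => E; have : 0 < - A j i by rewrite oppr_gt0 cartan_lt0.
rewrite -E; apply/negP; rewrite -leNgt; apply: sumr_le0 => k _.
apply: mulr_le0_ge0; last exact: delta0.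
rewrite mxE (bigD1 x) //= big1 ?addr0 => [|l lx]; last by rewrite mxE gammaE // mul0r.
rewrite mxE; apply: mulr_ge0_le0; first exact: gamma0.
have [->|kx] := eqVneq k x; first by rewrite skew_form_diag.
by rewrite (skew_form_gt (index_push_last pp kx)) cartan_le0 // eq_sym.
Qed.

Lemma word_mx_notin w (v : 'cV[R]_n) i : i \notin w -> (W w *m v) i 0 = v i 0.
Proof.
elim: w => [|x w IH] /=; first by rewrite mul1mx.
by rewrite inE negb_or => /andP[ix /IH]; rewrite -mulmxA refl_mulE (negbTE ix) mul0r subr0.
Qed.

(** Each letter y acts once, while its own coordinate is still 0, and sets it to -A y x plus
    nonnegative terms. *)
Lemma word_mx_uniq_ge w x r : uniq w -> x \notin w -> r != x ->
  0 <= W w r x /\ (r \in w -> - A r x <= W w r x).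
Proof.
elim: w r => [|y w IH] r; first by move=> _ _ rx; rewrite mxE (negbTE rx).
rewrite cons_uniq inE negb_or => /andP[yw uw] /andP[xy xw] rx.
rewrite -word_col [W _]/= -/(W w) -mulmxA refl_mulE inE; have [->|ry] := eqVneq r y; last first.
  by rewrite mul0r subr0 word_col; apply: IH.
have Wy : W w y x = 0 by rewrite -word_col word_mx_notin // mxE eq_sym (negbTE xy).
suff h : - A y x <= - (A *m (W w *m e x)) y 0.
  rewrite word_col Wy mul1r sub0r; split=> //; apply: le_trans h.
  by rewrite oppr_ge0 cartan_le0 // eq_sym.
rewrite lerN2 [leLHS]mxE (bigD1 x) //= word_col.
rewrite -[W w x x]word_col word_mx_notin // [e x x 0]mxE !eqxx mulr1 gerDl.
apply: sumr_le0 => k kx; rewrite word_col; have [->|ky] := eqVneq k y; first by rewrite Wy mulr0.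
by apply: mulr_le0_ge0; [apply: cartan_le0; rewrite // eq_sym | case: (IH k uw xw kx)].
Qed.

(* Compare the x-coordinates of c^-1 alpha_x computed from the two words: x q gives -1, while
   a x b gives -1 plus nonnegative terms, with a positive one for each neighbour of x in a. *)
Lemma initial_commute a x b q : perm_word (a ++ x :: b) -> perm_word (x :: q) ->
  x :: q ~~ a ++ x :: b -> forall j, j \in a -> m x j = 2.
Proof.
move=> /perm_word_uniq pp /perm_word_uniq /= /andP[xq uq] /(cox_eq_rev mC) pq j ja.
move: pp; rewrite cat_uniq /= negb_or => /and3P[ua /andP[xa _] /andP[xb _]].
have jx : j != x by apply: contraNneq xa => <-.
have xa' : x \notin rev a by rewrite mem_rev.
have := word_mx_eq R mC pq; rewrite rev_cons rev_cat rev_cons cat_rcons.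
rewrite word_mx_rcons word_mx_cat /= => /(congr1 (mulmx^~ (e x))).
rewrite -!mulmxA refl_root // mulmxN => /matrixP/(_ x 0).
rewrite [LHS]mxE word_mx_notin ?mem_rev // word_mx_notin ?mem_rev // refl_mulE eqxx mul1r.
rewrite word_col -[W _ x x]word_col word_mx_notin ?mem_rev // [e x x 0]mxE !eqxx [(A *m _) _ _]mxE.
rewrite (bigD1 x) //= word_col -[W _ x x]word_col word_mx_notin ?mem_rev // [e x x 0]mxE !eqxx.
rewrite cartan_diag // mulr1 => sum0.
have {}sum0 : \sum_(k | k != x) - (A x k * (W (rev a) *m e x) k 0) = 0.
  by rewrite sumrN; lra.
have ge0 k : k != x -> 0 <= - (A x k * (W (rev a) *m e x) k 0).
  move=> kx; rewrite oppr_ge0 word_col mulr_le0_ge0 ?cartan_le0 1?eq_sym //.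
  by have [] := @word_mx_uniq_ge (rev a) x k (etrans (rev_uniq a) ua) xa' kx.
have := psumr_eq0P ge0 sum0 jx => /eqP; rewrite oppr_eq0 word_col mulf_eq0.
have [_] := @word_mx_uniq_ge (rev a) x j (etrans (rev_uniq a) ua) xa' jx.
rewrite mem_rev => /(_ ja) aj.
have [xj|] := boolP (dyn x j); last first.
  by rewrite /dynkin_rel eq_sym jx negbK => /eqP.
have := cartan_lt0 R mC xj; rewrite (cartanC R mC x j) => Ajx.
by case/orP=> /eqP h; exfalso; lra.
Qed.

(** Letters before x in p commute with x, by [initial_commute]. So its neighbours come later, and x
    slides to the front, where conjugation carries it to the end. *)
Lemma initial_sink p c x : perm_word p -> p ~~ c -> initial m x c ->
  sink p x /\ push p x ~~ x :: c ++ [:: x].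
Proof.
move=> pp pc [q [pq qc]].
have [a [b [pE xa]]] := perm_word_split x pp; rewrite {}pE in pp pc *.
have com : forall j, j \in a -> m x j = 2.
  by apply: initial_commute pp pq _; rewrite pc.
split.
  move=> j /andP[xj m2]; have ja : j \notin a by apply: contraNN m2 => /com ->.
  by rewrite !index_cat (negbTE xa) (negbTE ja) /= eqxx (negbTE xj) ltn_add2l.
rewrite pushE // -pc -rcons_cat cats1 -rcons_cons; apply: cox_eq_rcons.
by rewrite -cat_rcons -cat_cons -(commute_word mC com) /= invol_cons.
Qed.

Lemma admissible_fires p c xs : perm_word p -> p ~~ c -> admissible m c xs -> fires p xs.
Proof.
elim: xs p c => [|x xs IH] p c pp pc //= [/(initial_sink pp pc)[sx cx] ax].
by split=> //; apply: IH cx ax; apply: perm_word_push.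
Qed.

(** w acts as a longest element: it makes simple roots nonpositive, while a prefix of u sends the
    simple root of the next letter to a nonnegative vector. So each letter of u shortens the product
    by one. *)
Lemma all_descents_max w u : reduced w -> (forall i, ~ reduced (rcons w i)) ->
  reduced u -> (size u <= size w)%N.
Proof.
move=> rw des.
suff h : reduced u ->
    exists2 v, w ++ u ~~ v & reduced v /\ (size v + size u = size w)%N.
  by case/h => v _ [_ <-]; rewrite leq_addl.
elim/last_ind: u => [_|u i IH rui]; first by exists w; rewrite ?cats0 ?addn0.
have ru := reduced_rconsl rui; have [v wuv [rv sv]] := IH ru.
have vi : forall k, W v k i <= 0.
  move=> k; rewrite -(word_mx_eq R mC wuv) word_mx_cat mxE; apply: sumr_le0 => l _.
  apply: mulr_le0_ge0; first exact: (descent_nonpos R mC rw (des l)).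
  exact: (reduced_nonneg R mC rui).
have [v' [rv' _ vv' sv']] := descentP mC rv (descent_of_nonpos mC rv vi).
exists v'; last by rewrite size_rcons; split=> //; lia.
by rewrite -rcons_cat -(rcons_invol mC v' i); apply: cox_eq_rcons; rewrite wuv.
Qed.

Lemma all_descents_finite w : reduced w -> (forall i, ~ reduced (rcons w i)) ->
  ~ coxeter_infinite m.
Proof.
move=> rw des; apply.
exists (map val (enum {: (size w).-bseq 'I_n})) => u.
have [v uv rv] := exists_reduced m u; exists v => //.
have sv := all_descents_max rw des rv.
by apply/mapP; exists (Bseq sv); rewrite ?mem_enum.
Qed.

Lemma fires_reduced p xs : coxeter_infinite m -> coxeter_irreducible m ->
  perm_word p -> fires p xs -> reduced xs.
Proof.
move=> inf irr pp; elim/last_ind: xs => [_ w //|w x IH /fires_rcons[fw sx]].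
have {IH} rw := IH fw; apply: contrapT => nrx.
have pq := perm_word_pushes w pp; set q := pushes p w in sx pq.
have [N hN] := fires_bound mC x pq irr.
(* Choose z as long as possible; connectedness gives the bound N. *)
pose P k := `[< exists z, [/\ size z = k, fires q z, x \notin z & reduced (w ++ z)] >].
have P0 : P 0%N by apply/asboolP; exists [::]; rewrite cats0.
have PN k : P k -> (k <= N)%N by move=> /asboolP[z [<- fz xz _]]; apply: hN.
have [k /asboolP[z [sz fz xz rwz]] kmax] := ex_maxnP (ex_intro (fun k => P k) 0%N P0) PN.
have [sxz com] := sink_pushes mC pq sx fz xz.
(* x commutes with every letter of z, so w z x equals w x z, which has the non-reduced factor w
   x. *)
have nrxz : ~ reduced (rcons (w ++ z) x).
  move=> r; apply: nrx; apply: (@reduced_factor _ _ [::] _ z).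
  apply: reduced_eq r; last by rewrite size_rcons !size_cat size_rcons addSn.
  by rewrite /= cat_rcons rcons_cat (commute_word mC com).
have fwz : fires p (w ++ z) by apply/fires_cat.
have pE : pushes p (w ++ z) = pushes q z by rewrite /pushes foldl_cat.
apply: (all_descents_finite rwz) inf => i.
(* Induct on the position of i in the orientation. A sink other than x is a descent by maximality of
   z; a non-sink has an earlier neighbour j, and [descent_up] passes the descent from j to i. *)
have [d] := ubnP (index i (pushes q z)); elim: d i => // d IH i id.
have [si|/existsNP[j /not_implyP[ij /negP]]] := pselect (sink (pushes q z) i).
  move=> ri; have ix : x != i by apply: contraPneq ri => <-.
  suff /kmax : P k.+1 by rewrite ltnn.
  apply/asboolP; exists (rcons z i); rewrite size_rcons sz -rcons_cat; split=> //.
    by apply/fires_rcons.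
  by rewrite mem_rcons inE negb_or ix.
rewrite -leqNgt => ji.
have {}ji : (index j (pushes q z) < index i (pushes q z))%N.
  rewrite ltn_neqAle ji andbT; apply: contraTneq ij => e.
  have iz := mem_perm_word i (perm_word_pushes z pq).
  have jz := mem_perm_word j (perm_word_pushes z pq).
  by rewrite -(nth_index i jz) e nth_index // /dynkin_rel eqxx.
apply: descent_up fwz rwz (IH j _) _ _ => //; rewrite ?pE //; first by lia.
by rewrite dynkin_sym.
Qed.
End Skew.

Theorem theorem4 (n : nat) (m : 'I_n -> 'I_n -> nat) :
  coxeter_matrix m ->
  coxeter_infinite m ->
  coxeter_irreducible m ->
  forall c : seq 'I_n, perm_word c ->
  forall xs : seq 'I_n, admissible m c xs ->
  reduced m xs.
Proof.
move=> mC inf irr c pc xs adm.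
have fx := admissible_fires Rdefinitions.R mC pc (cox_refl m c) adm.
exact: (fires_reduced Rdefinitions.R mC inf irr pc fx).
Qed.
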